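(* Let $R\subset\{x\in\mathbb{R}^n\mid x\ge\mathbf{0}\}$ be a non-empty up-monotone polyhedron with $V(R)\subset\{0,1\}^n$, and let $P=R\cap[0,1]^n$. Then $V(P)\subset\{0,1\}^n$.
   Context: $V(S)$ denotes the set of vertices of a polyhedron $S$. Vector inequalities are component-wise. A polyhedron $R$ is up-monotone if $x\in R$ and $y\ge x$ imply $y\in R$. *)

(* Defs.v *)
From mathcomp Require Import all_boot all_order all_algebra.
From mathcomp Require Import classical_sets reals.

Set Implicit Arguments.
Unset Strict Implicit.
Unset Printing Implicit Defensive.

Import Order.TTheory GRing.Theory Num.Theory.

Local Open Scope classical_set_scope.
Local Open Scope ring_scope.

Definition cvle (K : realType) (n : nat) (x y : 'cV[K]_n) : Prop :=
  forall i, x i 0 <= y i 0.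

Definition polyhedron (K : realType) (n : nat) (S : set 'cV[K]_n) : Prop :=
  exists (m : nat) (A : 'M[K]_(m, n)) (b : 'cV[K]_m),
    S = [set x | cvle (A *m x) b].

(* The normal vector c may be 0, so S itself is a face of S. *)
Definition face (K : realType) (n : nat) (S F : set 'cV[K]_n) : Prop :=
  exists (c : 'rV[K]_n) (d : K),
    (forall x, S x -> (c *m x) 0 0 <= d) /\
    F = S `&` [set x | (c *m x) 0 0 = d].

(* A vertex is a face consisting of a single point. *)
Definition vertices (K : realType) (n : nat) (S : set 'cV[K]_n) :
    set 'cV[K]_n :=
  [set v | face S [set v]].

Definition up_monotone (K : realType) (n : nat) (S : set 'cV[K]_n) : Prop :=
  forall x y, S x -> cvle x y -> S y.

Definition nonneg_orthant (K : realType) (n : nat) : set 'cV[K]_n :=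
  [set x | cvle 0 x].

Definition unit_cube (K : realType) (n : nat) : set 'cV[K]_n :=
  [set x | forall i, 0 <= x i 0 <= 1].

Definition zero_one_points (K : realType) (n : nat) : set 'cV[K]_n :=
  [set x | forall i, x i 0 = 0 \/ x i 0 = 1].

Arguments nonneg_orthant : clear implicits.
Arguments unit_cube : clear implicits.
Arguments zero_one_points : clear implicits.

(* Main.v *)
Require Import Defs.
From mathcomp Require Import all_boot all_order all_algebra.
From mathcomp Require Import classical_sets reals.
From mathcomp Require Import boolp lra.

(** Let [c] be a functional whose maximum over [P] is attained only at [v].
    Let [a] be the negative part of [c].  Since [a >= 0] and [R] is pointed,
    some vertex [u] of [R] satisfies [a u <= a v]; it is a 0/1 point.  Raising
    to 1 the coordinates of [u] where [c] is positive gives a 0/1 point of [P],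
    by up-monotonicity, at which [c] is at least [c v]; hence this point is
    [v]. *)

Import Order.TTheory GRing.Theory Num.Theory.

Local Open Scope classical_set_scope.
Local Open Scope ring_scope.

Section Polyhedra.
Variables (K : realType) (m n : nat) (A : 'M[K]_(m, n)) (b : 'cV[K]_m).

Let R : set 'cV[K]_n := [set x | cvle (A *m x) b].

Definition slack_rows (x : 'cV[K]_n) : {set 'I_m} :=
  [set j | (A *m x) j 0 != b j 0].

Lemma mulmx_shift (x z : 'cV[K]_n) (t : K) (j : 'I_m) :
  (A *m (x + t *: z)) j 0 = (A *m x) j 0 + t * (A *m z) j 0.
Proof. by rewrite mulmxDr -scalemxAr !mxE. Qed.

(* The sum of the tight rows exposes [x]. *)
Lemma tight_kernel0_vertex {x : 'cV[K]_n} : R x ->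
  (forall y : 'cV[K]_n,
    (forall j, j \notin slack_rows x -> (A *m y) j 0 = 0) -> y = 0) ->
  vertices R x.
Proof.
move=> Rx ker0; pose e : 'rV[K]_m := \row_j (j \notin slack_rows x)%:R.
have eE (z : 'cV[K]_n) : ((e *m A) *m z) 0 0 =
    \sum_(j | j \notin slack_rows x) (A *m z) j 0.
  rewrite -mulmxA mxE [RHS]big_mkcond; apply: eq_bigr => j _ /=.
  by rewrite mxE; case: ifP => _; rewrite ?mul1r ?mul0r.
have tight j : j \notin slack_rows x -> (A *m x) j 0 = b j 0.
  by rewrite inE negbK => /eqP.
exists (e *m A), (\sum_(j | j \notin slack_rows x) b j 0); split.
  by move=> z Rz; rewrite eE; apply: ler_sum => j _; apply: Rz.
apply/seteqP; split => z /=.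
  by move=> ->; split=> //; rewrite eE; apply: eq_bigr.
move=> [Rz]; rewrite eE => ez.
apply/eqP; rewrite -subr_eq0; apply/eqP/ker0 => j tj.
(* Nonnegative slacks with sum zero all vanish, so [z] is tight wherever [x] is. *)
have /eqP : \sum_(j | j \notin slack_rows x) (b j 0 - (A *m z) j 0) = 0.
  by rewrite sumrB ez subrr.
rewrite psumr_eq0; last by move=> k _; rewrite subr_ge0; apply: Rz.
move=> /allP /(_ j); rewrite mem_index_enum tj => /(_ isT) /eqP bz.
rewrite mulmxBr mxE [X in _ + X]mxE tight //; lra.
Qed.

(** The ray from [x] along [z] stays in [R], and a negative coordinate of [z] would take it out of
    the orthant. *)
Lemma recession_ge0 {x z : 'cV[K]_n} : R `<=` nonneg_orthant K n -> R x ->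
  cvle (A *m z) 0 -> cvle 0 z.
Proof.
move=> R0 Rx Az i; rewrite mxE leNgt; apply/negP => zi.
have xi : 0 <= x i 0 by have := R0 _ Rx i; rewrite mxE.
(* With this step, coordinate [i] of [x + t *: z] is exactly -1. *)
pose t := (x i 0 + 1) / - z i 0.
have t0 : 0 <= t by apply: divr_ge0; lra.
have Rt : R (x + t *: z).
  move=> j; rewrite mulmx_shift; have := Rx j; have := Az j; rewrite [leRHS]mxE => Azj.
  by have := mulr_ge0_le0 t0 Azj; lra.
have := R0 _ Rt i; rewrite !mxE.
have -> : t * z i 0 = - (x i 0 + 1) by rewrite /t invrN mulrN mulNr divfK ?lt_eqF.
by lra.
Qed.

(** Ratio test: follow [z] until the first constraint blocks. Rows tight at [x] stay tight because
    [A *m z] vanishes there, and the blocking row becomes tight. *)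
Lemma ratio_step {x z : 'cV[K]_n} : R x ->
  (forall j, j \notin slack_rows x -> (A *m z) j 0 = 0) ->
  ~ cvle (A *m z) 0 ->
  exists t : K, [/\ 0 <= t, R (x + t *: z) &
    (#|slack_rows (x + t *: z)| < #|slack_rows x|)%N].
Proof.
move=> Rx tz nAz.
have [j0 j0P] : exists j0, 0 < (A *m z) j0 0.
  apply: contrapT => h; apply: nAz => j; rewrite [leRHS]mxE leNgt; apply/negP => zj.
  by apply: h; exists j.
(* When [A *m z] is positive in row [j], this is the step length at which that row becomes tight. *)
pose r j := (b j 0 - (A *m x) j 0) / (A *m z) j 0.
case: (arg_minP r (P := fun j => 0 < (A *m z) j 0) j0P) => k zk kmin.
have t0 : 0 <= r k by apply: divr_ge0; [rewrite subr_ge0; apply: Rx|apply: ltW].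
exists (r k); split=> //.
  move=> j; rewrite mulmx_shift; have := Rx j.
  have [zj|zj] := ltP 0 ((A *m z) j 0); last first.
    by have := mulr_ge0_le0 t0 zj; lra.
  by have := kmin j zj; rewrite {2}/r ler_pdivlMr //; lra.
apply: proper_card; apply/properP; split.
  apply/fintype.subsetP => j; apply: contraLR => tj.
  by move: (tj); rewrite !inE !negbK mulmx_shift tz // mulr0 addr0.
exists k.
  by apply: contraTT zk => /tz ->; rewrite ltxx.
rewrite inE negbK mulmx_shift /r divfK; last by rewrite gt_eqF.
by apply/eqP; lra.
Qed.

(** Induction on the number of slack rows: a point whose tight rows have a nontrivial kernel can
    move along it, without increasing [a], until another row becomes tight. *)
Lemma vertex_le (a : 'rV[K]_n) : R `<=` nonneg_orthant K n ->
  (forall i, 0 <= a 0 i) ->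
  forall x, R x -> exists2 u, vertices R u & (a *m u) 0 0 <= (a *m x) 0 0.
Proof.
move=> R0 a0 x; have [N] := ubnP #|slack_rows x|.
elim: N x => // N IH x; rewrite ltnS => xN Rx.
have [[y [ty y0]]|noy] := pselect (exists y : 'cV[K]_n,
    (forall j, j \notin slack_rows x -> (A *m y) j 0 = 0) /\ y != 0); last first.
  exists x => //; apply: tight_kernel0_vertex => // y ty.
  by apply: contrapT => /eqP y0; apply: noy; exists y.
suff [z [tz az nAz]] : exists z : 'cV[K]_n,
    [/\ forall j, j \notin slack_rows x -> (A *m z) j 0 = 0,
        (a *m z) 0 0 <= 0 & ~ cvle (A *m z) 0].
  have [t [t0 Rt lt]] := ratio_step Rx tz nAz.
  have [u Vu au] := IH _ (leq_trans lt xN) Rt.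
  exists u => //; apply: le_trans au _.
  rewrite mulmxDr -scalemxAr mxE [X in _ + X]mxE.
  by have := mulr_ge0_le0 t0 az; lra.
have ge0 z : cvle 0 z -> 0 <= (a *m z) 0 0.
  by move=> z0; rewrite mxE sumr_ge0 // => i _; rewrite mulr_ge0 //;
    have := z0 i; rewrite mxE.
wlog ay : y ty y0 / (a *m y) 0 0 <= 0.
  move=> W; have [|ay] := leP ((a *m y) 0 0) 0; first exact: W.
  apply: (W (- y)); last by rewrite mulmxN mxE oppr_le0 ltW.
    by move=> j tj; rewrite mulmxN mxE ty ?oppr0.
  by rewrite oppr_eq0.
have [Ay|nAy] := pselect (cvle (A *m y) 0); last by exists y.
have yge := recession_ge0 R0 Rx Ay.
(* Here [y] is a recession direction, so [y >= 0] and [a] does not increase along [- y]. If [- y]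
   were one too, then [y = 0]. *)
exists (- y); split.
- by move=> j tj; rewrite mulmxN mxE ty ?oppr0.
- by rewrite mulmxN mxE oppr_le0 ge0.
- move=> /(recession_ge0 R0 Rx) nyge; case/eqP: y0; apply/matrixP => i j.
  rewrite ord1; have := yge i; have := nyge i; rewrite !mxE; lra.
Qed.

End Polyhedra.

Theorem corollary3p6 (K : realType) (n : nat) (R P : set 'cV[K]_n)
    (hpoly : polyhedron R)
    (hnneg : R `<=` nonneg_orthant K n)
    (hne : R !=set0)
    (hup : up_monotone R)
    (hV : vertices R `<=` zero_one_points K n)
    (hP : P = R `&` unit_cube K n) :
  vertices P `<=` zero_one_points K n.
Proof.
move=> v [c [d [cmax vE]]].
have [Pv cv] : (P `&` [set x | (c *m x) 0 0 = d]) v by rewrite -vE.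
move: (Pv); rewrite hP => -[Rv v01].
pose a : 'rV[K]_n := \row_i (if 0 < c 0 i then 0 else - c 0 i).
have a0 i : 0 <= a 0 i by rewrite mxE; case: ltP; lra.
have [u Vu au] : exists2 u, vertices R u & (a *m u) 0 0 <= (a *m v) 0 0.
  case: hpoly => m [A [b RE]]; move: hnneg Rv; rewrite RE => R0 Rv.
  exact: vertex_le.
have u01 := hV _ Vu.
have Ru : R u.
  by case: Vu => [c' [d' [_ E]]]; have : [set u] u by []; rewrite E => -[].
pose w : 'cV[K]_n := \col_i (if 0 < c 0 i then 1 else u i 0).
have w01 : zero_one_points K n w.
  by move=> i; rewrite mxE; case: ifP => _; [right|apply: u01].
have Pw : P w.
  rewrite hP; split; last by move=> i; case: (w01 i) => ->; rewrite ?lexx ?ler01.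
  by apply: hup Ru _ => i; rewrite mxE; case: ifP => // _;
    case: (u01 i) => ->; rewrite ?ler01.
suff -> : v = w by [].
suff cw : (c *m w) 0 0 = d.
  by have : (P `&` [set x | (c *m x) 0 0 = d]) w by []; rewrite -vE => ->.
apply/eqP; rewrite eq_le cmax //= -cv.
(* The bound on [a u] reduces the goal to a termwise one: where [c] is positive it reads
   [c_i v_i <= c_i], and elsewhere both sides are 0 since [w] agrees with [u] there. *)
suff : (c *m v) 0 0 + (a *m v) 0 0 <= (c *m w) 0 0 + (a *m u) 0 0 by lra.
rewrite !mxE -!big_split /=; apply: ler_sum => i _; rewrite !mxE.
have /andP[_ v1] := v01 i; case: ltP => ci; last by lra.
by rewrite !mul0r !addr0 ler_pM2l.
Qed.
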